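(* Let $\{\mathbf{s}_1,\dots,\mathbf{s}_M\}\subset\mathbb{R}^n$, $n\ge1$, be any constellation of $M\ge2$ distinct points used over the AWGN channel with maximum-likelihood detection, let $i\ne j$ and let $d_{ij}=|\mathbf{s}_i-\mathbf{s}_j|$. As a function of the SNR $\gamma>0$, the pairwise error probability $\Pr\{\mathbf{s}_i\to\mathbf{s}_j\}$ is: (a) convex on the range $\gamma\ge (n+\sqrt{2n})/d_{\min,i}^2$, for any $n$; (b) for $n=1,2$, concave on the range $\gamma\le (n+\sqrt{2n})/(d_{ij}+d_{\max,j})^2$; (c) for $n>2$, convex on the range $\gamma\le (n-\sqrt{2n})/(d_{ij}+d_{\max,j})^2$.
   Context: Setting: a constellation is a set of $M\ge2$ distinct points $\mathbf{s}_1,\dots,\mathbf{s}_M\in\mathbb{R}^n$, normalized by $\frac1M\sum_{i=1}^M|\mathbf{s}_i|^2=1$ ($|\cdot|$ is the Euclidean norm). The received vector is $\mathbf{r}=\mathbf{s}+\boldsymbol{\xi}$, $\mathbf{s}$ a constellation point, $\boldsymbol\xi\sim\mathcal N(\mathbf 0,\sigma_0^2\mathbf I)$, SNR $\gamma=1/\sigma_0^2>0$, and the maximum-likelihood detector outputs $\hat{\mathbf{s}}=\arg\min_{\mathbf{s}_k}|\mathbf{r}-\mathbf{s}_k|$. The pairwise error probability is $\Pr\{\mathbf{s}_i\to\mathbf{s}_j\}=\Pr[\hat{\mathbf{s}}=\mathbf{s}_j\mid\mathbf{s}=\mathbf{s}_i]$, i.e. the probability that $\mathbf{s}_i+\boldsymbol\xi$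 lies in the Voronoi region of $\mathbf{s}_j$ with respect to the whole constellation (not merely that it is closer to $\mathbf{s}_j$ than to $\mathbf{s}_i$). For each $k$, $\Omega_k=\{\mathbf{x}\in\mathbb{R}^n:\ (\mathbf{s}_l-\mathbf{s}_k)^T\mathbf{x}\le \frac12|\mathbf{s}_l-\mathbf{s}_k|^2\ \ \forall l\ne k\}$ is the decision region of $\mathbf{s}_k$ with the origin shifted to $\mathbf{s}_k$; $d_{\min,k}=\frac12\min_{l\ne k}|\mathbf{s}_l-\mathbf{s}_k|$ is the minimum, and $d_{\max,k}$ the maximum, distance from the origin to the boundary of $\Omega_k$, with $d_{\max,k}=\infty$ if $\Omega_k$ is unbounded (in which case the ranges in (b), (c) with $k=j$ are empty). *)

(* Defs.v *)
From HB Require Import structures.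
From mathcomp Require Import all_boot all_order all_algebra.
From mathcomp Require Import all_classical all_reals all_analysis.

Set Implicit Arguments.
Unset Strict Implicit.
Unset Printing Implicit Defensive.

Import Order.TTheory GRing.Theory Num.Theory.
Import numFieldNormedType.Exports.

Local Open Scope classical_set_scope.
Local Open Scope ring_scope.

Definition dotr (R : realType) (n : nat) (u v : 'rV[R]_n) : R :=
  (u *m v^T) ord0 ord0.

(* The norm that the library puts on ['rV[R]_n] is the sup norm. *)
Definition enorm (R : realType) (n : nat) (u : 'rV[R]_n) : R :=
  Num.sqrt (dotr u u).

Definition constellation (R : realType) (n M : nat) (s : 'I_M -> 'rV[R]_n) :=
  injective s /\ M%:R^-1 * (\sum_(k < M) enorm (s k) ^+ 2) = 1.

Section gaussian.
Variable R : realType.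
Local Notation mR := (measurableTypeR R).

Definition tcons (n : nat) (p : mR * n.-tuple mR) : n.+1.-tuple mR :=
  [the n.+1.-tuple mR of p.1 :: p.2].

Lemma measurable_tcons (n : nat) : measurable_fun setT (@tcons n).
Proof. exact: measurable_cons. Qed.

HB.instance Definition _ (n : nat) :=
  isMeasurableFun.Build _ _ _ _ (@tcons n) (@measurable_tcons n).

(* N(0, sigma^2 I) on R^n, as the law of n independent N(0, sigma^2)
   coordinates.  Matrices carry no measurable structure in the library, so the
   law lives on [n.-tuple R] with the product sigma-algebra. *)
Fixpoint gaussian (sigma : R) (n : nat) : probability (n.-tuple mR) R :=
  match n return probability (n.-tuple mR) R with
  | 0 => \d_[tuple]
  | n'.+1 =>
      distribution (normal_prob 0 sigma \x gaussian sigma n')%E (@tcons n')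
  end.

Definition rvec (n : nat) (t : n.-tuple mR) : 'rV[R]_n :=
  \row_(k < n) (tnth t k : R).

End gaussian.

(* A detector returns the index of the estimated point.  The Borel
   sigma-algebra of ['rV[R]_n] is read through [rvec]. *)
Definition measurable_detector (R : realType) (n M : nat)
    (det : 'rV[R]_n -> 'I_M) : Prop :=
  forall k : 'I_M,
    measurable [set t : n.-tuple (measurableTypeR R) | det (rvec t) = k].

(* How ties are broken is left free. *)
Definition ml_detector (R : realType) (n M : nat) (s : 'I_M -> 'rV[R]_n)
    (det : 'rV[R]_n -> 'I_M) : Prop :=
  forall (r : 'rV[R]_n) (k : 'I_M),
    enorm (r - s (det r)) <= enorm (r - s k).

(* The SNR [g] is the inverse of the noise variance, so that the standard
   deviation of the noise is the square root of [g^-1]. *)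
Definition pep (R : realType) (n M : nat) (s : 'I_M -> 'rV[R]_n)
    (det : 'rV[R]_n -> 'I_M) (i j : 'I_M) (g : R) : R :=
  fine (gaussian (Num.sqrt g^-1) n [set xi | det (s i + rvec xi) = j]).

Definition decision_region (R : realType) (n M : nat) (s : 'I_M -> 'rV[R]_n)
    (k : 'I_M) : set 'rV[R]_n :=
  [set x | forall l : 'I_M, l != k ->
    dotr (s l - s k) x <= 2^-1 * enorm (s l - s k) ^+ 2].

Definition dmin (R : realType) (n M : nat) (s : 'I_M -> 'rV[R]_n)
    (k : 'I_M) : R :=
  2^-1 * inf [set enorm (s l - s k) | l in [set l : 'I_M | l != k]].

Definition boundary (T : topologicalType) (A : set T) : set T :=
  closure A `\` interior A.

(* The sup and Euclidean norms have the same bounded sets and the same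
   topology, so [bounded_set] and [boundary] are the Euclidean notions. *)
Definition dmax (R : realType) (n M : nat) (s : 'I_M -> 'rV[R]_n)
    (k : 'I_M) : \bar R :=
  if `[< bounded_set (decision_region s k) >] then
    ereal_sup [set (enorm x)%:E | x in boundary (decision_region s k)]
  else +oo%E.

Definition concave_function (R : realType) (D : set R) (f : R -> R) : Prop :=
  convex_function D (fun x => - f x).

(* Main.v *)
(* N(0, g^-1 I) has density g^(n/2) exp(-(g-1)|x|^2/2) with respect to N(0, I).
   At a fixed x, the second derivative of this density in g is the density
   times ((n - g|x|^2)^2 - 2n) / (4g^2), so it is convex in g as long as g|x|^2
   is outside (n - sqrt(2n), n + sqrt(2n)), and concave inside.  The pairwise
   error probability is the integral of the density over the noise vectors x
   that turn s_i into s_j, hence is convex (concave) on a range of g for which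
   all these x are on the right side.  They satisfy |x| >= dmin_i, because
   s_i + x is not farther from s_j than from s_i, and |x| <= d_ij + dmax_j,
   because s_i + x - s_j is in Omega_j. *)

Require Import Defs.
From mathcomp Require Import all_boot all_order all_algebra.
From mathcomp Require Import all_classical all_reals all_analysis.
From mathcomp Require Import measurable_realfun ring lra.

Import Order.TTheory GRing.Theory Num.Theory.
Import numFieldNormedType.Exports.

Local Open Scope classical_set_scope.
Local Open Scope ring_scope.

(* The likelihood ratio of N(0, g^-1 I) to N(0, I) on R^n, at a point of squared
   Euclidean norm [r]. *)
Definition lratio (R : realType) (n : nat) (r g : R) : R :=
  expR (n%:R / 2 * ln g - (g - 1) / 2 * r).

(** * Convexity of the likelihood ratio in the SNR *)

Section lratio_convexity.
(* [e] is 1 for convexity and -1 for concavity. *)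
Variables (R : realType) (n : nat) (e r : R).

Let f (g : R) : R^o := e * lratio R n r g.

Lemma is_derive_lratio (g : R) : 0 < g ->
  is_derive g 1 f (f g * (n%:R / 2 / g - r / 2)).
Proof.
move=> g0; rewrite /f /lratio.
have dl := is_derive1_ln g0.
apply: is_derive_eq.
rewrite /GRing.scale /=.
field.
by rewrite gt_eqF.
Qed.

Lemma is_derive2_lratio (g : R) : 0 < g ->
  is_derive g 1 ('D_1 f)
   (lratio R n r g / (4 * g ^+ 2) * (e * ((n%:R - g * r) ^+ 2 - 2 * n%:R))).
Proof.
move=> g0.
have d2 : is_derive g 1 ((f : R -> R) * (fun g : R => n%:R / 2 * g^-1 - r / 2))
    (lratio R n r g / (4 * g ^+ 2) * (e * ((n%:R - g * r) ^+ 2 - 2 * n%:R))).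
  have dl := is_derive_lratio g g0.
  have dV : is_derive g 1 (fun g : R => g^-1) (- g ^- 2 *: 1).
    by apply: (@is_deriveV R id); rewrite //= gt_eqF.
  apply: is_derive_eq.
  rewrite /GRing.scale /= /f.
  field.
  by rewrite gt_eqF.
(* The product formula for ['D_1 f] is known only at positive points, hence on a neighbourhood of
   [g], which is enough to differentiate it there. *)
apply: near_eq_is_derive d2.
near=> z.
have z0 : 0 < z by near: z; exact: lt_nbhsr.
by have [_ ->] := is_derive_lratio z z0.
Unshelve. all: by end_near. Qed.

Lemma convex_lratio (D : set R) : is_interval D -> D `<=` [set g | 0 < g] ->
  (forall g, D g -> 0 <= e * ((n%:R - g * r) ^+ 2 - 2 * n%:R)) ->
  convex_function D f.
Proof.
move=> itvD D0 Dsign t a b; rewrite !inE => Da Db.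
(* The second-derivative criterion expects ordered endpoints; [convC] exchanges them. *)
wlog ab : t a b Da Db / a <= b.
  move=> wlg; have [|/ltW] := leP a b; first exact: wlg.
  by move=> ba; rewrite convC [leRHS]convC; exact: wlg.
have D0' x : a < x < b -> 0 < x.
  by move=> /andP[ax _]; exact: lt_trans (D0 _ Da) ax.
have cf x : 0 < x -> {for x, continuous f}.
  move=> x0; apply: differentiable_continuous; apply/derivable1_diffP.
  exact: @ex_derive _ _ _ _ _ _ _ (is_derive_lratio x x0).
apply: second_derivative_convex.
- move=> x xab; have [_ ->] := is_derive2_lratio _ (D0' _ xab).
  rewrite mulr_ge0//; last first.
    apply: Dsign; case/andP: xab => ax xb.
    by apply: (itvD a b) => //; rewrite !ltW.
  by rewrite divr_ge0 ?expR_ge0// mulr_ge0// sqr_ge0.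
- exact/cvg_at_left_filter/cf/D0.
- exact/cvg_at_right_filter/cf/D0.
- move=> x; rewrite in_itv/= => xab.
  by have [] := is_derive_lratio _ (D0' _ xab).
- move=> x; rewrite in_itv/= => xab.
  by have [] := is_derive2_lratio _ (D0' _ xab).
- exact: ab.
Qed.

End lratio_convexity.

(** * Change of measure from noise of variance [g^-1] to unit variance *)

Section gaussian_density.
Variable R : realType.
Local Notation mR := (measurableTypeR R).

(** The Radon-Nikodym derivative agrees almost everywhere with [normal_pdf], since both have the
    same integral over every measurable set. *)
Lemma ge0_integral_normal_prob (m sigma : R) (f : mR -> \bar R) :
  measurable_fun setT f -> (forall x, 0 <= f x)%E ->
  (\int[normal_prob m sigma]_x f x =
   \int[lebesgue_measure]_x (f x * (normal_pdf m sigma x)%:E))%E.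
Proof.
move=> mf f0; have dom := normal_prob_dominates m sigma.
rewrite -(Radon_Nikodym_SigmaFinite.change_of_variables dom)//.
have intRN := Radon_Nikodym_SigmaFinite.f_integrable dom.
have mpdf : measurable_fun setT (fun x : mR => (normal_pdf m sigma x)%:E).
  by apply/measurable_EFinP; exact: measurable_normal_pdf.
apply: ae_eq_integral => //.
- by apply: emeasurable_funM => //; exact: measurable_int intRN.
- exact: emeasurable_funM.
- apply: ae_eqe_mul2l; apply: integral_ae_eq => //.
  by move=> E _ mE; rewrite -Radon_Nikodym_SigmaFinite.f_integral.
Qed.

Lemma normal_pdf_lratio (g x : R) : 0 < g ->
  normal_pdf 0 (Num.sqrt g^-1) x = lratio R 1 (x ^+ 2) g * normal_pdf 0 1 x.
Proof.
move=> g0.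
have sg0 : Num.sqrt g^-1 != 0 by rewrite gt_eqF// sqrtr_gt0 invr_gt0.
rewrite !normal_pdfE// /normal_peak /normal_fun sqr_sqrtr ?invr_ge0 ?ltW//.
rewrite expr1n subr0 /lratio mul1r.
(* The factor [Num.sqrt g] is the quotient of the two normalizing constants. *)
have -> : expR (1 / 2 * ln g - (g - 1) / 2 * x ^+ 2) =
  Num.sqrt g * expR (- (g - 1) / 2 * x ^+ 2).
  rewrite expRD; congr (_ * _); last by rewrite !mulNr.
  apply/eqP; rewrite -(@eqrXn2 _ 2) ?expR_ge0 ?sqrtr_ge0//.
  rewrite sqr_sqrtr ?ltW// expr2 -expRD; apply/eqP.
  by rewrite -[RHS]lnK ?posrE//; congr expR; field.
rewrite -(mulrnAr g^-1) sqrtrM ?invr_ge0 ?ltW// sqrtrV ?ltW// invfM invrK.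
rewrite -!mulrA; congr (_ * _).
rewrite mulrCA; congr (_ * _).
rewrite -expRD; congr expR.
rewrite -mulr_natr; field.
by rewrite gt_eqF.
Qed.

(** Written on tuples, where measurability and splitting off a coordinate are direct; [sqnormE]
    links it to [enorm]. *)
Definition sqnorm (n : nat) (t : n.-tuple mR) : R :=
  \sum_(k < n) (tnth t k : R) ^+ 2.

Lemma measurable_sqnorm (n : nat) : measurable_fun setT (@sqnorm n).
Proof.
apply: measurable_sum => k; apply: measurable_funX.
exact: measurable_tnth.
Qed.

Definition gratio (n : nat) (g : R) (t : n.-tuple mR) : R :=
  lratio R n (sqnorm n t) g.

Lemma measurable_gratio (n : nat) (g : R) : measurable_fun setT (gratio n g).
Proof.
apply: measurableT_comp => //; apply: measurable_funB => //.
by apply: measurable_funM => //; exact: measurable_sqnorm.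
Qed.

Lemma gratio_cons (n : nat) (g : R) (p : mR * n.-tuple mR) :
  gratio n.+1 g (tcons p) = lratio R 1 (p.1 ^+ 2) g * gratio n g p.2.
Proof.
rewrite /gratio /lratio -expRD; congr expR.
rewrite /sqnorm big_ord_recl /= -natr1.
under eq_bigr do rewrite tnthS.
rewrite tnth0.
ring.
Qed.

(** Transfer along the pushforward by [tcons], then Tonelli: this gives the induction on the
    dimension its step. *)
Lemma ge0_integral_gaussianS (n : nat) (sigma : R)
    (f : n.+1.-tuple mR -> \bar R) :
  measurable_fun setT f -> (forall t, 0 <= f t)%E ->
  (\int[gaussian sigma n.+1]_t f t =
   \int[normal_prob 0 sigma]_x \int[gaussian sigma n]_t f (tcons (x, t)))%E.
Proof.
move=> mf f0; etransitivity.
  exact: (ge0_integral_distribution (P := (normal_prob 0 sigma \x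
    gaussian sigma n)%E) (@tcons R n) mf f0).
apply: (fubini_tonelli1 (f \o @tcons R n)) => [|p].
  exact: measurableT_comp mf (@measurable_tcons R n).
exact: f0.
Qed.

Lemma measurable_tcons_pair (n : nat) (x : mR) :
  measurable_fun setT (fun t : n.-tuple mR => tcons (x, t)).
Proof.
exact: measurableT_comp (@measurable_tcons R n) (measurable_pair1 x).
Qed.

Lemma measurable_integral_tcons (n : nat) (sigma : R)
    (f : n.+1.-tuple mR -> \bar R) :
  measurable_fun setT f -> (forall t, 0 <= f t)%E ->
  measurable_fun setT
    (fun x : mR => \int[gaussian sigma n]_t f (tcons (x, t)))%E.
Proof.
move=> mf f0.
apply: (measurable_fun_fubini_tonelli_F (f \o @tcons R n)) => [|p].
  exact: measurableT_comp mf (@measurable_tcons R n).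
exact: f0.
Qed.

Lemma ge0_integral_gaussian (n : nat) (g : R) (f : n.-tuple mR -> \bar R) :
  0 < g -> measurable_fun setT f -> (forall t, 0 <= f t)%E ->
  (\int[gaussian (Num.sqrt g^-1) n]_t f t =
   \int[gaussian 1 n]_t (f t * (gratio n g t)%:E))%E.
Proof.
have gr0 k t : (0 <= (gratio k g t)%:E)%E by rewrite lee_fin expR_ge0.
have mgr k : measurable_fun setT (fun t => (gratio k g t)%:E).
  by apply/measurable_EFinP; exact: measurable_gratio.
move=> g0; elim: n f => [|n IHn] f mf f0.
  (* In dimension 0 both laws are the same Dirac mass, and the ratio is 1. *)
  have mfg := emeasurable_funM mf (mgr 0).
  rewrite /= (integral_dirac _ _ mf) //.
  rewrite (integral_dirac _ _ mfg) //.
  congr (_ * _)%E.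
  by rewrite /gratio /lratio /sqnorm big_ord0 !mul0r mulr0 subr0 expR0 mule1.
have mfg := emeasurable_funM mf (mgr n.+1).
have fg0 t : (0 <= f t * (gratio n.+1 g t)%:E)%E by rewrite mule_ge0.
have If0 x : (0 <= \int[gaussian (Num.sqrt g^-1) n]_t f (tcons (x, t)))%E.
  by apply: integral_ge0 => t _; exact: f0.
have Ifg0 x : (0 <= \int[gaussian 1 n]_t
    (f (tcons (x, t)) * (gratio n.+1 g (tcons (x, t)))%:E))%E.
  by apply: integral_ge0 => t _; exact: fg0.
have mI := measurable_integral_tcons n (Num.sqrt g^-1) _ mf f0.
have mIg := measurable_integral_tcons n 1 _ mfg fg0.
apply: (eq_trans (ge0_integral_gaussianS n (Num.sqrt g^-1) _ mf f0)).
apply/esym/(eq_trans (ge0_integral_gaussianS n 1 _ mfg fg0))/esym.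
(* Both outer integrals become Lebesgue integrals, so it suffices to compare the integrands at each
   first coordinate [x]. *)
apply: (eq_trans (ge0_integral_normal_prob _ _ _ mI If0)).
apply/esym/(eq_trans (ge0_integral_normal_prob _ _ _ mIg Ifg0))/esym.
apply: eq_integral => x _.
rewrite normal_pdf_lratio// EFinM muleA; congr (_ * _)%E.
have mfx : measurable_fun setT (fun t => f (tcons (x, t))).
  exact: measurableT_comp mf (measurable_tcons_pair n x).
rewrite (IHn _ mfx)//.
rewrite muleC -ge0_integralZl//.
- by apply: eq_integral => t _; rewrite gratio_cons EFinM /= muleCA.
- exact: emeasurable_funM mfx (mgr n).
- by move=> t _; rewrite mule_ge0.
- by rewrite lee_fin expR_ge0.
Qed.

(** This moves the dependence on [g] from the measure to the integrand. *)
Lemma gaussianE (n : nat) (g : R) (A : set (n.-tuple mR)) :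
  0 < g -> measurable A ->
  gaussian (Num.sqrt g^-1) n A =
  (\int[gaussian 1 n]_(t in A) (gratio n g t)%:E)%E.
Proof.
move=> g0 mA.
have m1 : measurable_fun setT (EFin \o (\1_A : n.-tuple mR -> R)).
  by apply/measurable_EFinP; exact: measurable_indic.
have I1 (P : probability (n.-tuple mR) R) :
    P A = (\int[P]_t (EFin \o (\1_A : n.-tuple mR -> R)) t)%E.
  by rewrite integral_indic// setIT.
apply: (eq_trans (I1 _)).
apply: (eq_trans (ge0_integral_gaussian n g _ g0 m1 _)).
  by move=> t; rewrite lee_fin.
rewrite [RHS]integral_mkcond; apply: eq_integral => t _.
by rewrite patchE /= indicE; case: ifP; rewrite ?mul1e ?mul0e.
Qed.

Lemma integrable_gratio (n : nat) (g : R) (A : set (n.-tuple mR)) :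
  0 < g -> measurable A ->
  (gaussian 1 n).-integrable A (EFin \o gratio n g).
Proof.
move=> g0 mA; apply/integrableP; split.
  by apply/measurable_EFinP/measurable_funTS; exact: measurable_gratio.
(* The integral of the ratio over [A] is itself a probability, hence finite. *)
under eq_integral => t _ do rewrite /= ger0_norm ?expR_ge0//.
by rewrite -gaussianE// ltey_eq fin_num_measure.
Qed.

Lemma convex_gaussian (n : nat) (e : R) (D : set R) (A : set (n.-tuple mR)) :
  measurable A -> is_interval D -> D `<=` [set g | 0 < g] ->
  (forall t g, A t -> D g ->
    0 <= e * ((n%:R - g * sqnorm n t) ^+ 2 - 2 * n%:R)) ->
  convex_function D (fun g => e * fine (gaussian (Num.sqrt g^-1) n A)).
Proof.
move=> mA itvD D0 sgn p x y xD yD.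
have x0 : 0 < x by exact/D0/set_mem.
have y0 : 0 < y by exact/D0/set_mem.
rewrite convRE.
(* The integral formula [PE] is also needed at the convex combination. *)
have z0 : 0 < (conv p x y : R) by exact: convR_gt0.
have PE g : 0 < g -> e * fine (gaussian (Num.sqrt g^-1) n A) =
    \int[gaussian 1 n]_(t in A) (e * gratio n g t).
  by move=> g0; rewrite gaussianE// RintegralZl//; exact: integrable_gratio.
have ig (c g : R) : 0 < g ->
    (gaussian 1 n).-integrable A (EFin \o (fun t => c * gratio n g t)).
  move=> g0; under [X in _.-integrable _ X]eq_fun do rewrite /= EFinM.
  by apply: integrableZl => //; exact: integrable_gratio.
have igM (c g : R) : 0 < g ->
    (gaussian 1 n).-integrable A (EFin \o (fun t => c * (e * gratio n g t))).
  by move=> g0; under eq_fun do rewrite mulrA; exact: ig.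
rewrite !PE// -!RintegralZl//; [|exact: ig|exact: ig].
rewrite -RintegralD//; [|exact: igM|exact: igM].
apply: le_Rintegral => //.
- exact: ig.
- have := integrableD mA (igM p%:num x x0) (igM (unstable.onem p%:num) y y0).
  by apply: eq_integrable.
- move=> t At.
  apply: (@convex_lratio R n e (sqnorm n t) D itvD D0 _ p x y xD yD).
  by move=> g; exact: sgn.
Qed.

End gaussian_density.

(** * Euclidean geometry *)

Section euclidean.
Variables (R : realType) (n : nat).
Implicit Types u v w : 'rV[R]_n.

Lemma dotrE u v : dotr u v = \sum_k u ord0 k * v ord0 k.
Proof. by rewrite /dotr mxE; apply: eq_bigr => k _; rewrite mxE. Qed.

Lemma dotrC u v : dotr u v = dotr v u.
Proof. by rewrite !dotrE; apply: eq_bigr => k _; rewrite mulrC. Qed.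

Lemma dotrDl u v w : dotr (u + v) w = dotr u w + dotr v w.
Proof. by rewrite /dotr mulmxDl mxE. Qed.

Lemma dotrZl (a : R) u v : dotr (a *: u) v = a * dotr u v.
Proof. by rewrite /dotr -scalemxAl mxE. Qed.

Lemma dotrDr u v w : dotr w (u + v) = dotr w u + dotr w v.
Proof. by rewrite !(dotrC w) dotrDl. Qed.

Lemma dotrZr (a : R) u v : dotr v (a *: u) = a * dotr v u.
Proof. by rewrite !(dotrC v) dotrZl. Qed.

Lemma dotrNl u v : dotr (- u) v = - dotr u v.
Proof. by rewrite -scaleN1r dotrZl mulN1r. Qed.

Lemma dotrNr u v : dotr u (- v) = - dotr u v.
Proof. by rewrite dotrC dotrNl dotrC. Qed.

Lemma dotr_ge0 u : 0 <= dotr u u.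
Proof. by rewrite dotrE; apply: sumr_ge0 => k _; rewrite -expr2 sqr_ge0. Qed.

Lemma dotr_eq0 u : (dotr u u == 0) = (u == 0).
Proof.
rewrite dotrE psumr_eq0; last by move=> k _; rewrite -expr2 sqr_ge0.
apply/allP/eqP => [u0|-> k _]; last by rewrite mxE mulr0 eqxx.
apply/rowP => k; have := u0 k (mem_index_enum _).
by rewrite mxE mulf_eq0 orbb => /eqP.
Qed.

Lemma enorm_ge0 u : 0 <= enorm u.
Proof. exact: sqrtr_ge0. Qed.

Lemma sqr_enorm u : enorm u ^+ 2 = dotr u u.
Proof. by rewrite sqr_sqrtr// dotr_ge0. Qed.

Lemma enorm_eq0 u : (enorm u == 0) = (u == 0).
Proof. by rewrite -sqrf_eq0 sqr_enorm dotr_eq0. Qed.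

Lemma enorm_gt0 u : (0 < enorm u) = (u != 0).
Proof. by rewrite lt_neqAle enorm_ge0 andbT eq_sym enorm_eq0. Qed.

Lemma enormN u : enorm (- u) = enorm u.
Proof. by rewrite /enorm dotrNl dotrNr opprK. Qed.

Lemma enormZ (a : R) u : enorm (a *: u) = `|a| * enorm u.
Proof.
by rewrite /enorm dotrZl dotrZr mulrA -expr2 sqrtrM ?sqr_ge0// sqrtr_sqr.
Qed.

Lemma dotr_le_enorm u v : dotr u v <= enorm u * enorm v.
Proof.
have [->|v0] := eqVneq v 0.
  by rewrite -(scale0r u) dotrZr mul0r mulr_ge0// enorm_ge0.
apply: le_trans (ler_norm _) _.
rewrite -ler_sqr ?nnegrE ?mulr_ge0 ?enorm_ge0// real_normK ?num_real//.
rewrite exprMn !sqr_enorm.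
have vv : 0 < dotr v v by rewrite lt_neqAle eq_sym dotr_eq0 v0 dotr_ge0.
(* Cauchy-Schwarz: this square expands to [a * (c * a - b ^+ 2)], and [a] is positive. *)
have := dotr_ge0 (dotr v v *: u - dotr u v *: v).
rewrite !(dotrDl, dotrDr, dotrNl, dotrNr, dotrZl, dotrZr) (dotrC v u).
set a := dotr v v in vv *; set b := dotr u v; set c := dotr u u => h.
have : 0 <= a * (c * a - b ^+ 2) by lra.
by rewrite pmulr_rge0// subr_ge0.
Qed.

Lemma ler_enormD u v : enorm (u + v) <= enorm u + enorm v.
Proof.
rewrite -ler_sqr ?nnegrE ?addr_ge0 ?enorm_ge0// sqrrD !sqr_enorm.
rewrite dotrDl !dotrDr (dotrC v u); have := dotr_le_enorm u v; lra.
Qed.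

(** [dmax] measures boundary points only; this pushes any nonzero point of a bounded set outward to
    one. The factor is the supremum of the [t >= 0] with [t *: x] in [A]. *)
Lemma bounded_ray_exits_boundary (A : set 'rV[R]_n) (x : 'rV[R]_n) :
  bounded_set A -> A x -> x != 0 ->
  exists2 t : R, 1 <= t & boundary A (t *: x).
Proof.
move=> [M [_ bM]] Ax x0.
have x_gt0 : 0 < `|x| by rewrite normr_gt0.
pose T := [set t : R | 0 <= t /\ A (t *: x)].
have T1 : T 1 by split => //; rewrite scale1r.
have Tub : ubound T ((`|M| + 1) / `|x|).
  move=> t [t0 At]; rewrite ler_pdivlMr// -[t]ger0_norm// -normrZ.
  by apply: (bM (`|M| + 1)) => //; rewrite (le_lt_trans (ler_norm _))// ltrDl.
have supT : has_sup T by split; [exists 1 | exists ((`|M| + 1) / `|x|)].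
have cx (t : R) : (fun s : R => s *: x) @ t --> t *: x by exact: cvgZr_tmp.
exists (sup T); first exact: ub_le_sup (supT.2) _ T1.
split.
(* Closure: parameters in [T] come arbitrarily close to [sup T]. *)
- move=> B /cx /nbhs_ballP[d /= d0 dB].
  have [t Tt tT] := sup_adherent d0 supT.
  exists (t *: x); split; first by case: Tt.
  by apply: dB; rewrite /ball/= ger0_norm ?subr_ge0 ?ub_le_sup//;
    [lra | exact: supT.2].
(* Not interior: otherwise [sup T + d / 2] would belong to [T]. *)
- move=> /cx /nbhs_ballP[d /= d0 dB].
  have : A ((sup T + d / 2) *: x).
    apply: dB; rewrite /ball/= opprD addrA subrr sub0r normrN gtr0_norm; lra.
  have T0 : 0 <= sup T by rewrite (le_trans ler01)// ub_le_sup//; exact: supT.2.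
  move=> Ad; have := ub_le_sup supT.2 (x := sup T + d / 2).
  have : T (sup T + d / 2) by split => //; lra.
  move=> Td /(_ Td); lra.
Qed.

End euclidean.

Lemma sqnormE (R : realType) (n : nat) (t : n.-tuple (measurableTypeR R)) :
  sqnorm R n t = enorm (rvec t) ^+ 2.
Proof. by rewrite sqr_enorm dotrE; apply: eq_bigr => k _; rewrite mxE. Qed.

(** * Noise vectors that cause a given error *)

Section detection.
Variables (R : realType) (n M : nat) (s : 'I_M -> 'rV[R]_n).
Variable det : 'rV[R]_n -> 'I_M.
Implicit Types i j : 'I_M.

Lemma measurable_detector_shift (c : 'rV[R]_n) j : measurable_detector det ->
  measurable [set t : n.-tuple (measurableTypeR R) | det (c + rvec t) = j].
Proof.
move=> /(_ j) mdet.
pose shift (t : n.-tuple (measurableTypeR R)) : n.-tuple (measurableTypeR R) :=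
  [tuple (c ord0 k + tnth t k : measurableTypeR R) | k < n].
have mshift : measurable_fun setT shift.
  apply/measurable_fun_tnthP => k.
  rewrite (_ : _ \o _ = fun t => c ord0 k + tnth t k).
    by apply: measurable_funD => //; exact: measurable_tnth.
  by apply/funext => t /=; rewrite tnth_mktuple.
have := mshift measurableT _ mdet; rewrite setTI.
congr (measurable _); apply/funext => t /=; congr (det _ = _).
by apply/rowP => k; rewrite !mxE tnth_mktuple.
Qed.

Lemma dmin_gt0 i j : injective s -> i != j -> 0 < dmin s i.
Proof.
move=> sinj ij; rewrite /dmin mulr_gt0//.
have ji : j != i by rewrite eq_sym.
(* The minimum over the finitely many other points is attained; [j] shows that there is one, so
   [inf] does not take its default value 0. *)
have [l li lmin] := @Order.TotalTheory.arg_minP _ _ _ j (fun l => l != i)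
  (fun l => enorm (s l - s i)) ji.
apply: (@lt_le_trans _ _ (enorm (s l - s i))).
  by rewrite enorm_gt0 subr_eq0 (inj_eq sinj).
apply: lb_le_inf; first by exists (enorm (s j - s i)), j.
by move=> _ [k /= ki <-]; exact: lmin.
Qed.

Lemma dmin_le i j : i != j -> dmin s i <= enorm (s j - s i) / 2.
Proof.
move=> ij; rewrite /dmin mulrC ler_wpM2r//.
apply: ge_inf; last by exists j => //=; rewrite eq_sym.
by exists 0 => _ [k _ <-]; exact: enorm_ge0.
Qed.

Lemma enorm_le_dmax j (D : R) (x : 'rV[R]_n) :
  dmax s j = D%:E -> decision_region s j x -> enorm x <= D.
Proof.
rewrite /dmax; case: asboolP => // bdd supD Ox.
have le_D y : boundary (decision_region s j) y -> enorm y <= D.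
  by move=> By; rewrite -lee_fin -supD; apply: ereal_sup_ubound; exists y.
(* The origin spans no ray. Any boundary point gives [0 <= D], and an empty boundary would make the
   supremum [-oo] instead of [D]. *)
have [->|x0] := eqVneq x 0.
  have [[y By]|noB] := pselect (exists y, boundary (decision_region s j) y).
    apply: le_trans (le_D _ By).
    by rewrite (eqP (_ : enorm 0 == 0)) ?enorm_eq0// enorm_ge0.
  move: supD; rewrite (_ : [set _ | _ in _] = set0) ?ereal_sup0//.
  by apply/seteqP; split=> // z [y By _]; case: noB; exists y.
have [t t1 Bt] := bounded_ray_exits_boundary _ _ _ _ bdd Ox x0.
apply: le_trans (le_D _ Bt).
by rewrite enormZ ger0_norm ?(le_trans ler01)// ler_peMl// enorm_ge0.
Qed.

(** With [u] and [v] as set in the proof, expanding [|u|^2 <= |u - v|^2] leaves [2 v.u <= |v|^2]. *)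
Lemma ml_decision_region (r : 'rV[R]_n) : ml_detector s det ->
  decision_region s (det r) (r - s (det r)).
Proof.
move=> /(_ r) ml l _; have := ml l.
rewrite -ler_sqr ?nnegrE ?enorm_ge0// !sqr_enorm.
have -> : r - s l = (r - s (det r)) - (s l - s (det r)).
  by rewrite opprB addrA subrK.
set u := r - _; set v := s l - _; move: u v => u v.
rewrite !(dotrDl, dotrDr, dotrNl, dotrNr) (dotrC _ _ u v); lra.
Qed.

Lemma ml_error_ge i j (x : 'rV[R]_n) : ml_detector s det -> i != j ->
  det (s i + x) = j -> dmin s i <= enorm x.
Proof.
move=> ml ij detj; apply: le_trans (dmin_le _ _ ij) _.
have := ml (s i + x) i.
rewrite detj [X in _ <= enorm X]addrAC subrr add0r => mlx.
(* The triangle inequality bounds [|s_j - s_i|] by [|x| + |s_i + x - s_j|], which is at most [2|x|]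
   by [mlx]. *)
have := ler_enormD _ _ x (- (s i + x - s j)).
rewrite enormN (_ : x - _ = s j - s i); last first.
  by apply/rowP => k; rewrite !mxE; ring.
lra.
Qed.

Lemma ml_error_le i j (D : R) (x : 'rV[R]_n) :
  ml_detector s det -> dmax s j = D%:E ->
  det (s i + x) = j -> enorm x <= enorm (s i - s j) + D.
Proof.
move=> ml dmaxD detj.
have /(_ (s i + x)) := ml_decision_region _ ml; rewrite detj.
move=> /(enorm_le_dmax _ _ _ dmaxD) xD.
have := ler_enormD _ _ (- (s i - s j)) (s i + x - s j).
rewrite enormN (_ : - _ + _ = x); last by apply/rowP => k; rewrite !mxE; ring.
lra.
Qed.

End detection.

(** * From bounds on the noise to ranges of the SNR *)

Lemma threshold_ge (R : realType) (T d g x : R) :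
  0 < d -> d <= x -> 0 < g -> T / d ^+ 2 <= g -> T <= g * x ^+ 2.
Proof.
move=> d0 dx g0; rewrite ler_pdivrMr ?exprn_gt0// => /le_trans; apply.
by rewrite ler_pM2l// ler_sqr ?nnegrE ?(ltW d0)// (le_trans (ltW d0)).
Qed.

Lemma threshold_le (R : realType) (T d g x : R) :
  0 < d -> 0 <= x <= d -> 0 < g -> g <= T / d ^+ 2 -> g * x ^+ 2 <= T.
Proof.
move=> d0 /andP[x0 xd] g0; rewrite ler_pdivlMr ?exprn_gt0//; apply: le_trans.
by rewrite ler_pM2l// ler_sqr ?nnegrE// (le_trans x0).
Qed.

Theorem theorem4 (R : realType) (n M : nat) (s : 'I_M -> 'rV[R]_n)
    (det : 'rV[R]_n -> 'I_M) (i j : 'I_M) :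
  (1 <= n)%N -> (2 <= M)%N -> constellation s ->
  measurable_detector det -> ml_detector s det -> i != j ->
  [/\ convex_function
        [set g : R | 0 < g /\
           (n%:R + Num.sqrt (2 * n%:R)) / dmin s i ^+ 2 <= g]
        (pep s det i j),
      n = 1%N \/ n = 2%N ->
      forall D : R, dmax s j = D%:E ->
      concave_function
        [set g : R | 0 < g /\
           g <= (n%:R + Num.sqrt (2 * n%:R)) / (enorm (s i - s j) + D) ^+ 2]
        (pep s det i j) &
      (2 < n)%N ->
      forall D : R, dmax s j = D%:E ->
      convex_function
        [set g : R | 0 < g /\
           g <= (n%:R - Num.sqrt (2 * n%:R)) / (enorm (s i - s j) + D) ^+ 2]
        (pep s det i j)].
Proof.
move=> n1 M2 [sinj _] mdet ml ij.
have mA := measurable_detector_shift _ _ _ _ (s i) j mdet.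
set q := Num.sqrt (2 * n%:R : R).
have q0 : 0 <= q by exact: sqrtr_ge0.
have q2 : q ^+ 2 = 2 * n%:R by rewrite sqr_sqrtr// mulr_ge0.
(* As a quadratic in [X], here [g |x|^2], this has roots [n - q] and [n + q]. *)
have signE X : (n%:R - X) ^+ 2 - 2 * n%:R = (X - n%:R - q) * (X - n%:R + q).
  by rewrite -q2; ring.
have dij0 : 0 < enorm (s i - s j) by rewrite enorm_gt0 subr_eq0 (inj_eq sinj).
(* [D] is nonnegative because the origin lies in the decision region. *)
have E0 D : dmax s j = D%:E -> 0 < enorm (s i - s j) + D.
  move=> dmaxD; rewrite ltr_wpDr//.
  have O0 : decision_region s j 0.
    move=> l _; rewrite dotrC -(scale0r (s l)) dotrZl mul0r.
    by rewrite mulr_ge0// sqr_ge0.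
  exact: le_trans (enorm_ge0 _ _ 0) (enorm_le_dmax _ _ _ _ _ _ _ dmaxD O0).
have itv_le c : is_interval [set g : R | 0 < g /\ g <= c].
  move=> a b [a0 _] [_ bc] g /andP[ag gb].
  by split; [exact: lt_le_trans ag|exact: le_trans gb _].
have cvx e (P : set R) :
    is_interval [set g | 0 < g /\ P g] ->
    (forall x g, det (s i + x) = j -> 0 < g -> P g ->
      0 <= e * ((g * enorm x ^+ 2 - n%:R - q) *
                (g * enorm x ^+ 2 - n%:R + q))) ->
    convex_function [set g | 0 < g /\ P g] (fun g => e * pep s det i j g).
  move=> itvP sgn.
  apply: (convex_gaussian R n e _ _ mA itvP) => [g []//|t g At [g0 Pg]].
  by rewrite signE sqnormE; exact: sgn.
have pep1 : pep s det i j = (fun g => 1 * pep s det i j g).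
  by apply/funext => g; rewrite mul1r.
split; first rewrite pep1.
- apply: cvx => [a b [a0 aT] _ c /andP[ac _]|x g detx g0 gT].
    by split; [exact: lt_le_trans ac|exact: le_trans ac].
  (* Here [g |x|^2] is at least the larger root, so both factors are nonnegative. *)
  have := threshold_ge _ _ _ _ _ (dmin_gt0 _ _ _ _ _ _ sinj ij)
    (ml_error_ge _ _ _ _ _ _ _ _ ml ij detx) g0 gT.
  by move=> h; rewrite mul1r; apply: mulr_ge0; lra.
- move=> n12 D dmaxD; rewrite /concave_function.
  rewrite (_ : (fun g => - _) = (fun g => -1 * pep s det i j g)); last first.
    by apply/funext => g; rewrite mulN1r.
  apply: cvx (itv_le _) _ => x g detx g0 gT.
  have xE : 0 <= enorm x <= enorm (s i - s j) + D.
    by rewrite enorm_ge0; exact: (ml_error_le _ _ _ _ _ _ _ _ _ ml dmaxD detx).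
  have := threshold_le _ _ _ _ _ (E0 _ dmaxD) xE g0 gT.
  have : 0 <= g * enorm x ^+ 2 by rewrite mulr_ge0 ?sqr_ge0 ?ltW.
  (* For [n] at most 2 the smaller root [n - q] is nonpositive, so [g |x|^2] lies between the
     roots. *)
  have nq : n%:R <= q.
    rewrite -ler_sqr ?nnegrE// q2 expr2 ler_wpM2r// ler_nat.
    by case: n12 => ->.
  by move=> ? ?; rewrite mulN1r oppr_ge0; apply: mulr_le0_ge0; lra.
- move=> n3 D dmaxD; rewrite pep1.
  apply: cvx (itv_le _) _ => x g detx g0 gT.
  have xE : 0 <= enorm x <= enorm (s i - s j) + D.
    by rewrite enorm_ge0; exact: (ml_error_le _ _ _ _ _ _ _ _ _ ml dmaxD detx).
  (* Now [g |x|^2] is at most the smaller root, so both factors are nonpositive. *)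
  have := threshold_le _ _ _ _ _ (E0 _ dmaxD) xE g0 gT.
  by move=> h; rewrite mul1r; apply: mulr_le0; lra.
Qed.
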